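(* Let $(X,d,\mu)$ be a metric measure space (with negligible cut loci), with geodesic dimension $\mathcal{N}(x)$ at $x\in X$. Then, for any Borel subset $B\subseteq X$, $$\sup\{\mathcal{N}(x)\mid x\in B\}\ \ge\ \dim_H(B),$$ where $\dim_H(B)$ is the Hausdorff dimension of $B$ in $(X,d)$.
   Context: **Metric measure spaces.** A metric measure space $(X,d,\mu)$ is a length space $(X,d)$ (i.e. $d(x,y)=\inf_\gamma\ell(\gamma)$ over rectifiable curves from $x$ to $y$) with a Borel measure $\mu$ such that $0<\mu(\mathcal{B}(x,r))<+\infty$ for all metric balls $\mathcal{B}(x,r)$ with $x\in X$, $r>0$, having negligible cut loci: for any $x\in X$ there exist a $\mu$-negligible set $\mathcal{C}(x)$ and a measurable map $\Phi^x:(X\setminus\mathcal{C}(x))\times[0,1]\to X$ (fixed from now on) such that $t\mapsto\Phi^x(y,t)$ is the unique (constant speed) minimizing geodesic from $x$ to $y$. **Homothety.** For $\Omega\subseteq X$, $x\in X$, $t\in[0,1]$, the geodesic homothety of center $x$ and ratio $t$ is $\Omega_t:=\{\Phi^x(y,t)\mid y\in\Omega\setminus\mathcal{C}(x)\}$. **Geodesic dimension.** For $x\in X$ and $s>0$, $$C_s(x):=\sup\left\{\limsup_{t\to0^+}\frac{1}{t^s}\frac{\mu(\Omega_t)}{\mu(\Omega)}\ \Big|\ \Omega\text{ measurable, bounded, }0<\mu(\Omega)<+\infty\right\},$$ where $\Omega_t$ is the homothety with center $x$. The geodesic dimension at $x$ is $$\mathcal{N}(x):=\inf\{s>0\mid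 C_s(x)=+\infty\}=\sup\{s>0\mid C_s(x)=0\},$$ with the conventions $\inf\emptyset=+\infty$ and $\sup\emptyset=0$. *)

(* Defs.v *)
From HB Require Import structures.
From mathcomp Require Import all_boot all_order all_algebra.
From mathcomp Require Import all_classical all_reals all_analysis.

Set Implicit Arguments.
Unset Strict Implicit.
Unset Printing Implicit Defensive.
Import Order.TTheory GRing.Theory Num.Theory.
Import numFieldNormedType.Exports.

Local Open Scope classical_set_scope.
Local Open Scope ring_scope.

(* MathComp-Analysis requires measurable types to be pointed, hence metric
   spaces are nonempty here. *)
#[short(type="pmetricType")]
HB.structure Definition PointedMetric (R : numDomainType) :=
  {M of Pointed M & Metric R M}.

Notation borel X := (g_sigma_algebraType (@open X)).

Section metric.
Context {R : realType} {X : metricType R}.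
Implicit Types (x y : X) (A B : set X) (g : R -> X).

Local Open Scope ereal_scope.

Definition metric_bounded A := exists x r, A `<=` ball x r.

Definition diameter A : \bar R :=
  supremum 0 [set (mdist x y)%:E | x in A & y in A].

(* The length of the restriction of g to [a, b]: `itv_partition a b s` says
   that a :: s is a strictly increasing subdivision of [a, b]. *)
Definition curve_length (a b : R) g : \bar R :=
  let poly_length (s : seq R) :=
    let p := g \o nth b (a :: s) in
    (\sum_(0 <= n < size s) mdist (p n) (p n.+1))%R in
  ereal_sup [set (poly_length s)%:E | s in itv_partition a b].

Definition curve_from_to x y g :=
  [/\ {within `[0%R, 1%R], continuous g}, g 0%R = x & g 1%R = y].

Definition rectifiable g := curve_length 0 1 g < +oo.

Definition constant_speed g := exists v : R,
  forall s t : R, (0 <= s)%R -> (s <= t)%R -> (t <= 1)%R ->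
    curve_length s t g = (v * (t - s))%:E.

Definition minimizing_geodesic x y g :=
  [/\ curve_from_to x y g, constant_speed g
    & curve_length 0 1 g = (mdist x y)%:E].

(* Hausdorff pre-measures and measures, without normalizing constant.  The
   empty set contributes 0, also when s = 0, so that a finite cover can be
   completed to a sequence by empty sets. *)
Definition hausdorff_weight (s : R) A : \bar R :=
  if A == set0 then 0 else poweR (diameter A) s.

Definition hausdorff_premeasure (s delta : R) A : \bar R :=
  ereal_inf [set \sum_(i <oo) hausdorff_weight s (U i) |
    U in [set U : (set X)^nat |
      A `<=` \bigcup_i U i /\ forall i, diameter (U i) <= delta%:E]].

Definition hausdorff_measure (s : R) A : \bar R :=
  ereal_sup [set hausdorff_premeasure s delta A |
    delta in [set delta : R | (0 < delta)%R]].

Definition hausdorff_dim A : \bar R :=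
  ereal_inf [set s%:E |
    s in [set s : R | (0 <= s)%R /\ hausdorff_measure s A = 0]].

End metric.

Definition length_space {R : realType} (X : metricType R) :=
  forall x y : X, (mdist x y)%:E = ereal_inf [set curve_length 0 1 g |
    g in [set g : R -> X | curve_from_to x y g /\ rectifiable g]].

(* Measurability of f on an arbitrary subset D of T, i.e. with respect to the
   trace of the sigma-algebra of T on D.  The library's `measurable_fun D f`
   holds vacuously when D is not measurable, while the complement of a
   negligible set need not be. *)
Definition trace_measurable_fun d d' (T : measurableType d)
    (U : measurableType d') (D : set T) (f : T -> U) :=
  preimage_set_system D f measurable `<=` preimage_set_system D id measurable.

Section metric_measure_space.
Context {R : realType} {X : pmetricType R}.
Variables (mu : {measure set (borel X) -> \bar R})
  (C : X -> set X) (Phi : X -> X -> R -> X).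

Local Open Scope ereal_scope.

(* C x is the set removed at x, and Phi x y t the point denoted by
   Phi^x(y, t); only its values for y outside of C x and t in [0, 1] matter. *)
Record negligible_cut_loci : Prop := NegligibleCutLoci {
  cut_locus_negligible : forall x, mu.-negligible (C x) ;
  geodesic_map_measurable : forall x,
    trace_measurable_fun (T := (borel X * R)%type) (U := borel X)
      ((~` C x) `*` `[0%R, 1%R]) (fun p => Phi x p.1 p.2) ;
  geodesic_mapP : forall x y, ~ C x y -> minimizing_geodesic x y (Phi x y) ;
  geodesic_map_uniq : forall x y g, ~ C x y -> minimizing_geodesic x y g ->
    {in `[0%R, 1%R], g =1 Phi x y} }.

Record metric_measure_space : Prop := MetricMeasureSpace {
  mms_length_space : length_space X ;
  mms_ball : forall (x : X) (r : R), (0 < r)%R -> 0 < mu (ball x r) < +oo ;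
  mms_cut_loci : negligible_cut_loci }.

Definition homothety (x : X) (t : R) (Omega : set X) : set X :=
  [set Phi x y t | y in Omega `\` C x].

(* The homothety of a Borel set need not be a Borel set: its measure is taken
   with respect to the outer measure induced by mu, which extends mu and its
   completion. *)
Definition homothety_ratio (s : R) (x : X) (Omega : set X) (t : R) : \bar R :=
  (t `^ s)^-1%:E * ((mu^*)%mu (homothety x t Omega) / mu Omega).

Definition geodesic_dim_coef (s : R) (x : X) : \bar R :=
  ereal_sup [set limf_esup (homothety_ratio s x Omega) 0^'+ |
    Omega in [set Omega : set (borel X) |
      [/\ measurable Omega, metric_bounded (Omega : set X)
        & 0 < mu Omega < +oo]]].

Definition geodesic_dim (x : X) : \bar R :=
  ereal_inf [set s%:E |
    s in [set s : R | (0 < s)%R /\ geodesic_dim_coef s x = +oo]].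

End metric_measure_space.

Section geodesic_dim_sup.
Context {R : realType} {X : pmetricType R}.
Variables (mu : {measure set (borel X) -> \bar R})
  (C : X -> set X) (Phi : X -> X -> R -> X).
Context (hX : metric_measure_space mu C Phi).

Local Open Scope ereal_scope.

Let ratio_ge0 s x (O : set X) t : 0 <= homothety_ratio mu C Phi s x O t.
Proof.
rewrite /homothety_ratio mule_ge0 ?lee_fin ?invr_ge0 ?powR_ge0//.
by rewrite mule_ge0 ?inve_ge0 ?mu_ext_ge0.
Qed.

Let open_ball x (r : R) : open (ball x r : set X).
Proof.
rewrite openE => y; rewrite ballEmdist /= => xy; apply/nbhs_ballP.
exists (r - mdist x y)%R; first by rewrite /= subr_gt0.
move=> z; rewrite !ballEmdist /= ltrBrDl; apply: le_lt_trans.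
exact: metric_triangle.
Qed.

Lemma geodesic_dim_coef_ge0 s x : 0 <= geodesic_dim_coef mu C Phi s x.
Proof.
apply: (@le_trans _ _
    (limf_esup (homothety_ratio mu C Phi s x (ball x 1%R)) 0^'+)).
  exact: limf_esup_ge0.
apply: ereal_sup_ubound; exists (ball x 1%R : set X) => //; split.
- by apply: sub_sigma_algebra; exact: open_ball.
- by exists x, 1%R.
- exact: (mms_ball hX).
Qed.

Lemma geodesic_dim_coef_jump (s s' : R) x : (s < s')%R ->
  geodesic_dim_coef mu C Phi s x != 0 -> geodesic_dim_coef mu C Phi s' x = +oo.
Proof.
move=> ss' coef0.
have /ereal_sup_gt[_ [Om HOm <-]] : 0 < geodesic_dim_coef mu C Phi s x.
  by rewrite lt_def coef0 geodesic_dim_coef_ge0.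
move=> lim_gt0; apply/eqP; rewrite -leye_eq.
suff <- : limf_esup (homothety_ratio mu C Phi s' x Om) 0^'+ = +oo.
  by apply: ereal_sup_ubound; exists Om.
apply/eqP; rewrite -leye_eq; apply: le_ereal_inf_tmp => _ [V V0 <-].
rewrite leye_eq; apply/eqP/eq_infty => M.
have [e e0 elim] : exists2 e : R, (0 < e)%R &
    e%:E < limf_esup (homothety_ratio mu C Phi s x Om) 0^'+.
  move: lim_gt0; case: limf_esup => [r||//].
  - by rewrite lte_fin => r0; exists (r / 2)%R; rewrite ?lte_fin ?divr_gt0//
      ltr_pdivrMr// ltr_pMr// ltr1n.
  - by move=> _; exists 1%R; rewrite ?ltry.
pose K : R := Num.max (M / e)%R 1%R.
have K0 : (0 < K)%R by rewrite lt_max ltr01 orbT.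
pose del : R := (K `^ (- (s' - s)^-1))%R.
have del0 : (0 < del)%R by rewrite powR_gt0.
pose W := V `&` `]0%R, del[.
have W0 : (0 : R)^'+ W.
  apply: filterI => //; near=> t; rewrite /= in_itv/=; apply/andP; split; near: t.
    exact: nbhs_right_gt.
  exact: nbhs_right_lt.
have : e%:E < ereal_sup (homothety_ratio mu C Phi s x Om @` W).
  by apply: (lt_le_trans elim); apply: ereal_inf_lbound; exists W.
move=> /ereal_sup_gt[_ [t [Vt +] <-] et]; rewrite /= in_itv/= => /andP[t0 tdel].
apply: (@le_trans _ _ (homothety_ratio mu C Phi s' x Om t)); last first.
  by apply: ereal_sup_ubound; exists t.
have -> : homothety_ratio mu C Phi s' x Om t =
    ((t `^ (s' - s))^-1)%:E * homothety_ratio mu C Phi s x Om t.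
  rewrite /homothety_ratio [RHS]muleA -EFinM -invfM -powRD ?subrK//.
  by rewrite (gt_eqF t0) implybT.
have tK : (K <= (t `^ (s' - s))^-1)%R.
  rewrite -[leLHS]invrK lef_pV2 ?posrE ?invr_gt0 ?powR_gt0//.
  have <- : (del `^ (s' - s))%R = K^-1%R.
    by rewrite /del -powRrM mulNr mulVf ?powR_inv1 ?ltW// subr_eq0 gt_eqF.
  by rewrite ge0_ler_powR ?nnegrE ?subr_ge0 ?ltW.
apply: (@le_trans _ _ (K%:E * e%:E)).
  by rewrite -EFinM lee_fin -ler_pdivrMr// le_max lexx.
by apply: lee_pmul; rewrite ?lee_fin// ltW.
Unshelve. all: by end_near. Qed.

Lemma geodesic_dimE x : geodesic_dim mu C Phi x =
  supremum 0 [set s%:E |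
    s in [set s : R | (0 < s)%R /\ geodesic_dim_coef mu C Phi s x = 0]].
Proof.
set S := [set _ | _ in _].
have [ubS geS] : (forall y, S y -> y <= supremum 0 S) /\
    (forall M, 0 <= M -> (forall y, S y -> y <= M) -> supremum 0 S <= M).
  have [->|S0] := eqVneq S set0; first by rewrite supremum0; split.
  have -> : supremum 0 S = ereal_sup S.
    rewrite /ereal_sup /supremum (negbTE S0).
    have [y Hy] := ereal_supremums_neq0 S.
    have E z : xget z (supremums S) = y.
      by case: xgetP => [w _ Hw|/(_ y)//]; exact: is_subset1_supremums Hw Hy.
    by rewrite !E.
  split=> [y|M _]; first exact: ereal_sup_ubound.
  exact: ge_ereal_sup.
apply/eqP; rewrite eq_le; apply/andP; split; last first.
  apply: geS.
    by apply: le_ereal_inf_tmp => _ [s [s0 _] <-]; rewrite lee_fin ltW.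
  move=> _ [s [s0 cs] <-]; apply: le_ereal_inf_tmp => _ [s' [s'0 cs'] <-].
  rewrite lee_fin leNgt; apply/negP => s's.
  have := geodesic_dim_coef_jump (x := x) s's.
  by rewrite cs' cs => /(_ isT).
have S_ge0 : 0 <= supremum 0 S.
  have [->|/set0P[y Sy]] := eqVneq S set0; first by rewrite supremum0.
  by apply: le_trans (ubS _ Sy); case: Sy => s [s0 _] <-; rewrite lee_fin ltW.
case supE : (supremum 0 S) => [r| |].
- apply/lee_addgt0Pr => e e0; apply: ereal_inf_lbound; exists (r + e)%R => //.
  have r0 : (0 <= r)%R by rewrite -lee_fin -supE.
  split; first exact: ltr_wpDl.
  apply: (@geodesic_dim_coef_jump (r + e / 2)%R).
    by rewrite ltrD2l ltr_pdivrMr// ltr_pMr// ltr1n.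
  apply/eqP => c0; have : (r + e / 2)%:E <= r%:E.
    by rewrite -supE; apply: ubS; exists (r + e / 2)%R;
      rewrite //= ltr_wpDl// divr_gt0.
  by rewrite lee_fin leNgt ltrDl divr_gt0.
- by rewrite leey.
- by move: S_ge0; rewrite supE.
Qed.
End geodesic_dim_sup.

(* Main.v *)
(* If N(x) < s < a, some bounded Omega has mu(Omega_t) >= c t^s for arbitrarily
   small t > 0.  Omega_t lies in a ball of radius O(t) around x because points
   move along minimizing geodesics of constant speed, so
   mu(ball(x, 2^-n)) >= 2^-(na) for infinitely many n.

   If this holds at every x in B and a < s, then H^s(B) = 0.  In a bounded part
   of B, let E_n be the set of points x for which the bound holds at scale
   2^-n.  A 2^(1-n)-separated subset of E_n has O(2^(na)) points, since the
   balls of radius 2^-n around them are disjoint and lie in a fixed ball of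
   finite measure.  Hence E_n is covered by sets of total weight
   O(2^(-n(s-a))), which is summable in n, and every tail of (E_n) covers the
   bounded part of B. *)
Require Import Defs.
From HB Require Import structures.
From mathcomp Require Import all_boot all_order all_algebra.
From mathcomp Require Import all_classical all_reals all_analysis.
Set Implicit Arguments.
Unset Strict Implicit.
Unset Printing Implicit Defensive.
Import Order.TTheory GRing.Theory Num.Theory.
Import numFieldNormedType.Exports.
Local Open Scope classical_set_scope.
Local Open Scope ring_scope.
Local Open Scope ereal_scope.

(** * Real powers, dyadic scales and suprema *)

Lemma geometric_le (R : realType) (c z e : R) : (`|z| < 1)%R -> (0 < e)%R ->
  \forall n \near \oo, (c * z ^+ n <= e)%R.
Proof. by move=> z1; apply: cvgr_le; exact: cvg_geometric. Qed.

Lemma powR_half_lt1 (R : realType) (p : R) : (0 < p)%R -> (2^-1 `^ p < 1)%R.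
Proof.
move=> p0; rewrite [ltRHS](_ : _ = 1 `^ p)%R; last by rewrite powR1.
by rewrite gt0_ltr_powR ?nnegrE// invf_lt1// ltr1n.
Qed.

Lemma powR_exprn (R : realType) (x p : R) n : (0 <= x)%R ->
  ((x ^+ n) `^ p = (x `^ p) ^+ n)%R.
Proof. by move=> x0; rewrite -!powR_mulrn ?powR_ge0// powRAC. Qed.

(** The least m with 2^-m < u exceeds [n0], so it is a successor; its predecessor is [n], by
    minimality. *)
Lemma dyadic_scale (R : realType) (u : R) n0 : (0 < u)%R -> (u <= 2^-1 ^+ n0)%R ->
  exists2 n, (n0 <= n)%N & (2^-1 ^+ n.+1 < u <= 2^-1 ^+ n)%R.
Proof.
move=> u0 un0.
have half_lt1 : (2^-1 < 1 :> R)%R by rewrite invf_lt1// ltr1n.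
have uex : exists n, (2^-1 ^+ n < u)%R.
  near \oo => n; exists n; near: n.
  apply: (@cvgr_lt _ _ _ _ (GRing.exp 2^-1 : R^nat) 0%R) => //.
  by apply: cvg_expr; rewrite ger0_norm.
case: (ex_minnP uex) => m mu minm.
have : (n0 < m)%N.
  by rewrite -(@ltr_iXn2l R 2^-1)//; exact: lt_le_trans un0.
case: m mu minm => // n nu minn n0n; exists n => //.
by rewrite nu leNgt; apply/negP => /minn; rewrite ltnn.
Unshelve. all: by end_near. Qed.

Lemma supremum0_ge0 (R : realType) (S : set (\bar R)) :
  (forall y, S y -> 0 <= y) -> 0 <= supremum 0 S.
Proof.
have [-> _|/set0P[y Sy] S0] := eqVneq S set0; first by rewrite supremum0.
apply: le_trans (S0 y Sy) _.
by apply: ge_supremum_Nmem => //; exact: ereal_supremums_neq0.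
Qed.

(** * Diameters and Hausdorff pre-measures *)

Section metric_space.
Context {R : realType} {X : pmetricType R}.
Implicit Types (x y : X) (A B D E : set X) (s delta r : R).

Lemma diameter_le A r : (0 <= r)%R ->
  (forall x y, A x -> A y -> (mdist x y <= r)%R) -> diameter A <= r%:E.
Proof.
move=> r0 Ar; rewrite /diameter; set S := [set _ | _ in _ & _ in _].
have [->|S0] := eqVneq S set0; first by rewrite supremum0 lee_fin.
rewrite leNgt; apply/negP => rS.
have : ubound S r%:E by move=> _ [x Ax [y Ay <-]]; rewrite lee_fin Ar.
(* [supremum] picks its value by choice among the suprema, so uniqueness is needed to identify it
   with [z]. *)
have [z Sz] := ereal_supremums_neq0 S.
have zE : supremum 0 S = z.
  rewrite /supremum (negbTE S0); case: xgetP => [w _ Sw|/(_ z)//].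
  exact: is_subset1_supremums Sw Sz.
by case: Sz => _ /[apply]; rewrite leNgt -zE rS.
Qed.

Lemma diameter_ge0 A : 0 <= diameter A.
Proof.
by apply: supremum0_ge0 => _ [x Ax [y Ay <-]]; rewrite lee_fin mdist_ge0.
Qed.

Lemma diameter_ball x r : (0 <= r)%R -> diameter (ball x r) <= (2 * r)%:E.
Proof.
move=> r0; apply: diameter_le => [|y z]; first by rewrite mulr_ge0.
rewrite !ballEmdist/= mulr_natl mulr2n => xy xz.
by rewrite (le_trans (metric_triangle _ x _))// metric_sym ltW// ltrD.
Qed.

Lemma hausdorff_weight_ge0 s A : 0 <= hausdorff_weight s A.
Proof. by rewrite /hausdorff_weight; case: ifP => // _; exact: poweR_ge0. Qed.

Lemma hausdorff_weight_le s A r : (0 <= s)%R ->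
  diameter A <= r%:E -> hausdorff_weight s A <= (r `^ s)%:E.
Proof.
move=> s0 Ar; rewrite /hausdorff_weight; case: ifP => _.
  by rewrite lee_fin powR_ge0.
have r0 : 0 <= r%:E by rewrite (le_trans (diameter_ge0 A)).
by rewrite -poweR_EFin gt0_ler_poweR// in_itv/= ?diameter_ge0 ?r0 leey.
Qed.

(** The value [+oo] on sets of large diameter moves the size restriction from the covers into the
    weight, as [mu_ext] requires. *)
Let fine_weight s delta A :=
  if diameter A <= delta%:E then hausdorff_weight s A else +oo.

Let fine_weight_ge0 s delta A : 0 <= fine_weight s delta A.
Proof.
by rewrite /fine_weight; case: ifP => // _; exact: hausdorff_weight_ge0.
Qed.

(* The Hausdorff pre-measure is the outer measure generated by a set function
   on the discrete sigma-algebra. *)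
Let hausdorff_premeasureE s delta :
  hausdorff_premeasure s delta =
  mu_ext (T := g_sigma_algebraType [set: set X]) (fine_weight s delta).
Proof.
apply/funext => A; apply/eqP; rewrite eq_le; apply/andP; split.
  apply: le_ereal_inf_tmp => _ [U [_ AU] <-].
  have [Ud|/existsNP[i Ui]] := pselect (forall i, diameter (U i) <= delta%:E).
    apply: ereal_inf_lbound; exists U; first by split.
    by apply: eq_eseriesr => i _; rewrite /fine_weight Ud.
  rewrite (@eseries_pinfty _ _ _ i) ?leey//.
    by move=> n _; rewrite gt_eqF// (lt_le_trans _ (fine_weight_ge0 _ _ _)).
  by rewrite /fine_weight ifF//; apply/negP.
apply: le_ereal_inf_tmp => _ [U [AU Ud] <-].
apply: ereal_inf_lbound; exists U.
  by split=> // i; exact: sub_sigma_algebra.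
by apply: eq_eseriesr => i _; rewrite /fine_weight Ud.
Qed.

Lemma hausdorff_premeasure_sigma_subadditive s delta :
  sigma_subadditive (hausdorff_premeasure s delta : set X -> _).
Proof.
rewrite hausdorff_premeasureE => F.
exact: (@mu_ext_sigma_subadditive _ (g_sigma_algebraType [set: set X])).
Qed.

Lemma le_hausdorff_premeasure s delta A B :
  A `<=` B -> hausdorff_premeasure s delta A <= hausdorff_premeasure s delta B.
Proof.
rewrite hausdorff_premeasureE.
exact: (@le_mu_ext _ (g_sigma_algebraType [set: set X])).
Qed.

Lemma hausdorff_premeasure_ge0 s delta A : 0 <= hausdorff_premeasure s delta A.
Proof.
rewrite hausdorff_premeasureE.
exact: (@mu_ext_ge0 _ (g_sigma_algebraType [set: set X])).
Qed.

(** Reduces null sets to a fixed [delta], where countable subadditivity is available. *)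
Lemma hausdorff_measure_eq0P s A :
  hausdorff_measure s A = 0 <->
  forall delta, (0 < delta)%R -> hausdorff_premeasure s delta A = 0.
Proof.
split=> [A0 delta delta0|A0]; apply/eqP; rewrite eq_le.
  rewrite hausdorff_premeasure_ge0 andbT -A0.
  by apply: ereal_sup_ubound; exists delta.
apply/andP; split.
  by apply: ge_ereal_sup => _ [delta delta0 <-]; rewrite A0.
by rewrite -(A0 1%R)//; apply: ereal_sup_ubound; exists 1%R => /=.
Qed.

Lemma hausdorff_measure_bigcup0 s (F : (set X)^nat) :
  (forall n, hausdorff_measure s (F n) = 0) ->
  hausdorff_measure s (\bigcup_n F n) = 0.
Proof.
move=> F0; apply/hausdorff_measure_eq0P => delta delta0.
apply/eqP; rewrite eq_le hausdorff_premeasure_ge0 andbT.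
apply: le_trans (hausdorff_premeasure_sigma_subadditive _ _ _) _.
by rewrite eseries0// => n _ _; exact: (hausdorff_measure_eq0P _ _).1.
Qed.

Lemma hausdorff_premeasure_seq_ball s delta r A (t : seq X) :
  (0 <= s)%R -> (0 <= r)%R -> (2 * r <= delta)%R ->
  A `<=` \bigcup_(x in [set` t]) ball x r ->
  hausdorff_premeasure s delta A <= ((size t)%:R * (2 * r) `^ s)%:E.
Proof.
move=> s0 r0 rdelta At.
(* The finite cover is padded with empty sets, which have weight 0 even when s = 0. *)
pose U i := if (i < size t)%N then ball (nth point t i) r else set0.
have Ud i : diameter (U i) <= (2 * r)%:E.
  rewrite /U; case: ifP => _; first exact: diameter_ball.
  by apply: diameter_le => //; rewrite mulr_ge0.
apply: (@le_trans _ _ (\sum_(i <oo) hausdorff_weight s (U i))).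
  apply: ereal_inf_lbound; exists U => //; split => [x /At|i]; last first.
    by rewrite (le_trans (Ud i))// lee_fin.
  move=> [y /= ty yx].
  by exists (index y t) => //; rewrite /U index_mem ty nth_index.
rewrite (nneseries_split _ (size t)); last first.
  by move=> *; exact: hausdorff_weight_ge0.
rewrite [X in _ + X]eseries0 ?adde0 => [|i ti _]; last first.
  by rewrite /U ltnNge ti/= /hausdorff_weight eqxx.
rewrite add0n big_mkord.
apply: (@le_trans _ _ (\sum_(i < size t) ((2 * r) `^ s)%:E)).
  by apply: lee_sum => i _; exact: hausdorff_weight_le.
by rewrite sumEFin sumr_const card_ord [(_%:R * _ `^ _)%R]mulr_natl.
Qed.

(** * Packing, covering and lower volume bounds *)

Lemma measurable_ball x r : measurable (ball x r : set (borel X)).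
Proof.
apply: sub_sigma_algebra; rewrite openE => y; rewrite ballEmdist /= => xy.
apply/nbhs_ballP; exists (r - mdist x y)%R; first by rewrite /= subr_gt0.
move=> z; rewrite !ballEmdist /= ltrBrDl; apply: le_lt_trans.
exact: metric_triangle.
Qed.

Variable mu : {measure set (borel X) -> \bar R}.

(** The balls are disjoint by the triangle inequality. The induction removes one ball from [D] at
    each step, and the others still lie in what remains. *)
Lemma measure_separated_balls r (m : R) D (t : seq X) :
  measurable (D : set (borel X)) ->
  pairwise (fun x y => 2 * r <= mdist x y)%R t ->
  (forall x, x \in t -> m%:E <= mu (ball x r) /\ ball x r `<=` D) ->
  ((size t)%:R * m)%:E <= mu D.
Proof.
elim: t D => [|x t IH] D mD /=; first by rewrite mul0r measure_ge0.
move=> /andP[/allP xt tt] tm.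
have [mx xD] := tm x (mem_head _ _).
rewrite -(setDUK xD).
have mDx : measurable (D `\` ball x r : set (borel X)).
  exact: measurableD mD (measurable_ball _ _).
rewrite measureU//; [|exact: measurable_ball|by rewrite setDIK].
rewrite -natr1 mulrDl mul1r EFinD addeC leeD// IH// => y ty.
have [my yD] := tm y (mem_behead (s := x :: t) ty); split=> // z yz; split.
  exact: yD.
move: yz; rewrite !ballEmdist/= => yz xz.
have := xt _ ty; rewrite leNgt => /negP; apply.
by rewrite (le_lt_trans (metric_triangle _ z _))// mulr_natl mulr2n ltrD// metric_sym.
Qed.

(* The witness is a maximal 2r-separated sequence of points of E. *)
Lemma separated_cover r (m : R) D E : (0 < m)%R ->
  measurable (D : set (borel X)) -> mu D < +oo ->
  (forall x, E x -> m%:E <= mu (ball x r) /\ ball x r `<=` D) ->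
  exists2 t : seq X, E `<=` \bigcup_(x in [set` t]) ball x (2 * r) &
    ((size t)%:R * m)%:E <= mu D.
Proof.
move=> m0 mD Doo Em; apply: contrapT => noncover.
(* A separated sequence satisfies the measure bound, so by [noncover] it misses a point of [E] and
   can be extended: every length occurs. *)
have sep n : exists t : seq X, [/\ size t = n,
    pairwise (fun x y => 2 * r <= mdist x y)%R t & {in t, forall x, E x}].
  elim: n => [|n [t [tn tsep tE]]]; first by exists [::].
  have /existsNP[x /not_implyP[Ex xt]] :
      ~ (E `<=` \bigcup_(x in [set` t]) ball x (2 * r)).
    move=> Et; apply: noncover; exists t => //.
    by apply: (@measure_separated_balls r) => // x /tE /Em.
  exists (x :: t); split=> [||y]; rewrite /= ?tn//.
    rewrite tsep andbT; apply/allP => y ty; rewrite leNgt; apply/negP => xy.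
    by apply: xt; exists y => //; rewrite ballEmdist/= metric_sym.
  by rewrite inE => /predU1P[->//|/tE].
have Dfin : mu D \is a fin_num by rewrite ge0_fin_numE.
(* This length exceeds mu(D) / m, against the packing bound. *)
have [t [tn tsep tE]] := sep (Num.truncn (fine (mu D) / m)).+1.
have : ((size t)%:R * m)%:E <= mu D.
  by apply: (@measure_separated_balls r) => // x /tE /Em.
rewrite -(fineK Dfin) lee_fin -ler_pdivlMr// tn leNgt => /negP; apply.
by rewrite truncnS_gt.
Qed.

(** At most V r^-a balls of radius 2r suffice, and each weighs at most (4r)^s. *)
Lemma hausdorff_premeasure_scale s a delta r (V : R) D E : (0 <= s)%R ->
  (0 < r)%R -> (2 * (2 * r) <= delta)%R ->
  measurable (D : set (borel X)) -> mu D = V%:E ->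
  (forall x, E x -> (r `^ a)%:E <= mu (ball x r) /\ ball x r `<=` D) ->
  hausdorff_premeasure s delta E <= (V * 4 `^ s * r `^ (s - a))%:E.
Proof.
move=> s0 r0 rdelta mD DV Er; have ra0 : (0 < r `^ a)%R by rewrite powR_gt0.
have [|t Et tV] := separated_cover ra0 mD _ Er; first by rewrite DV ltry.
have r20 : (0 <= 2 * r)%R by rewrite mulr_ge0// ltW.
apply: le_trans (hausdorff_premeasure_seq_ball s0 r20 rdelta Et) _.
rewrite lee_fin.
have -> : ((2 * (2 * r)) `^ s = r `^ a * (4 `^ s * r `^ (s - a)))%R.
  rewrite mulrA -natrM powRM ?ltW// mulrCA -powRD ?subrKC//.
  by apply/implyP => _; rewrite gt_eqF.
by rewrite mulrA -[leRHS]mulrA ler_wpM2r ?mulr_ge0 ?powR_ge0// -lee_fin -DV.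
Qed.

Lemma hausdorff_measure_density0 s a B : (0 <= s)%R -> (a < s)%R ->
  (forall x r, (0 < r)%R -> mu (ball x r) < +oo) ->
  (forall x n0, B x -> exists2 n, (n0 <= n)%N &
    ((2^-1 ^+ n) `^ a)%:E <= mu (ball x (2^-1 ^+ n))) ->
  hausdorff_measure s B = 0.
Proof.
move=> s0 as_ muoo Bmu.
have -> : B = \bigcup_k (B `&` ball point k%:R).
  rewrite -setI_bigcupr; apply/esym/setIidPl => x _.
  exists (Num.truncn (mdist point x)).+1 => //.
  by rewrite ballEmdist/= truncnS_gt.
apply: hausdorff_measure_bigcup0 => k; set E := _ `&` _.
apply/hausdorff_measure_eq0P => delta delta0.
apply/eqP; rewrite eq_le hausdorff_premeasure_ge0 andbT.
(* The extra 1 makes room for every ball of radius 2^-n <= 1 centred in [E]. *)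
pose D : set X := ball point (k%:R + 1)%R.
have mD : measurable (D : set (borel X)) by exact: measurable_ball.
pose V := fine (mu D).
have DV : mu D = V%:E by rewrite fineK// ge0_fin_numE// muoo.
pose rho n : R := (2^-1 ^+ n)%R.
have rho0 n : (0 < rho n)%R by rewrite exprn_gt0.
pose En n := [set x | E x /\ ((rho n) `^ a)%:E <= mu (ball x (rho n))].
have EnD n x : En n x ->
    (rho n `^ a)%:E <= mu (ball x (rho n)) /\ ball x (rho n) `<=` D.
  move=> [[_ kx] xn]; split=> // y; move: kx; rewrite /D !ballEmdist/= => kx xy.
  rewrite (le_lt_trans (metric_triangle _ x _))// ltrD//.
  by rewrite (lt_le_trans xy)// exprn_ile1// invf_le1// ler1n.
pose q : R := (2^-1 `^ (s - a))%R.
have rhoq n : (rho n `^ (s - a) = q ^+ n)%R by exact: powR_exprn.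
have q0 : (0 <= q)%R by exact: powR_ge0.
have q1 : (q < 1)%R by rewrite powR_half_lt1// subr_gt0.
have nq1 : (`|q| < 1)%R by rewrite ger0_norm.
pose c := (V * 4 `^ s)%R.
have c0 : (0 <= c)%R by rewrite mulr_ge0 ?powR_ge0 ?fine_ge0.
apply/lee_addgt0Pr => e e0; rewrite add0e.
(* [N] is so large that the covers at scales n >= [N] have diameters at most [delta], and that the
   sum c q^N / (1 - q) of their weight bounds is at most [e]. *)
near \oo => N.
have Ndelta n : (N <= n)%N -> (2 * (2 * rho n) <= delta)%R.
  move=> Nn; apply: (@le_trans _ _ (2 * (2 * rho N)))%R.
    by rewrite !ler_pM2l// ler_wiXn2l// invf_le1// ler1n.
  rewrite mulrA; near: N; apply: geometric_le => //.
  by rewrite ger0_norm// invf_lt1// ltr1n.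
apply: (@le_trans _ _ (hausdorff_premeasure s delta (\bigcup_i En (i + N)%N))).
  apply: le_hausdorff_premeasure => x Ex; have [n Nn xn] := Bmu x N Ex.1.
  by exists (n - N)%N => //; rewrite subnK.
apply: le_trans (hausdorff_premeasure_sigma_subadditive _ _ _) _.
apply: (@le_trans _ _ (\sum_(i <oo) (geometric (c * q ^+ N) q i)%:E)).
  apply: lee_nneseries => [i _ _|i _]; first exact: hausdorff_premeasure_ge0.
  rewrite /geometric/= -mulrA -exprD -rhoq [(N + _)%N]addnC.
  exact: (hausdorff_premeasure_scale s0 (rho0 _) (Ndelta _ (leq_addl _ _))
    mD DV (EnD _)).
have -> : \sum_(i <oo) (geometric (c * q ^+ N) q i)%:E =
    (c * q ^+ N / (1 - q))%:E.
  apply/cvg_lim => //; apply: cvg_EFin.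
    by apply: nearW => n; rewrite sumEFin.
  rewrite (_ : fine \o _ = series (geometric (c * q ^+ N) q)); last first.
    by apply/funext => n; rewrite /= sumEFin.
  exact: cvg_geometric_series.
rewrite lee_fin mulrAC; near: N; exact: geometric_le.
Unshelve. all: by end_near. Qed.

End metric_space.

(** * Homotheties and the measure of small balls *)

Lemma minimizing_geodesic_mdist (R : realType) (X : metricType R) (x y : X) g t :
  minimizing_geodesic x y g -> (0 < t)%R -> (t <= 1)%R ->
  (mdist x (g t) <= t * mdist x y)%R.
Proof.
move=> [[_ g0 _] [v gv] gxy] t0 t1.
have vxy : v = mdist x y.
  by apply/EFin_inj; rewrite -gxy gv// subr0 mulr1.
(* The right-hand side is the length of [g] on [0, t], which bounds the chord through the
   subdivision with a single interval. *)
rewrite -lee_fin -vxy mulrC -[t in (v * t)%R]subr0 -gv//; last exact: ltW.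
apply: ereal_sup_ubound; exists [:: t]; first exact: itv_partition1.
by rewrite /= big_nat1/= g0.
Qed.

Section geodesic_dim.
Context {R : realType} {X : pmetricType R}.
Variables (mu : {measure set (borel X) -> \bar R})
  (C : X -> set X) (Phi : X -> X -> R -> X).
Hypothesis hX : metric_measure_space mu C Phi.

Lemma homothety_sub_ball (x : X) (r t : R) (Omega : set X) :
  (0 < t)%R -> (t <= 1)%R -> Omega `<=` ball x r ->
  homothety C Phi x t Omega `<=` ball x (t * r)%R.
Proof.
move=> t0 t1 Or _ [y [/Or + Cy] <-]; rewrite !ballEmdist/= => xy.
apply: (@le_lt_trans _ _ (t * mdist x y)%R); last by rewrite ltr_pM2l.
apply: minimizing_geodesic_mdist => //.
exact: geodesic_mapP (mms_cut_loci hX) _ _ Cy.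
Qed.

Lemma geodesic_dim_lt_ball (x : X) (a : R) n0 : geodesic_dim mu C Phi x < a%:E ->
  exists2 n, (n0 <= n)%N &
    ((2^-1 ^+ n) `^ a)%:E <= mu (ball x (2^-1 ^+ n)%R).
Proof.
move=> /ereal_inf_lt[_ [s [s0 coefs] <-]]; rewrite lte_fin => sa.
have /ereal_sup_gt[_ [Om [mOm [y [r Omr]] /andP[Om0 Omoo]] <-]] :
    0 < geodesic_dim_coef mu C Phi s x by rewrite coefs.
set L := limf_esup _ _ => L0.
have [e e0 eL] : exists2 e : R, (0 < e)%R & e%:E < L.
  move: L0; case: L => [l| |]; rewrite ?lte_fin// => l0.
    exists (l / 2)%R; rewrite ?lte_fin ?divr_gt0//.
    by rewrite ltr_pdivrMr// ltr_pMr// ltr1n.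
  by exists 1%R; rewrite ?ltry.
pose m := fine (mu Om).
have mE : mu Om = m%:E by rewrite fineK// ge0_fin_numE// ltW.
have m0 : (0 < m)%R by rewrite -lte_fin -mE.
(* A ball around [x] is needed instead of the given one around [y]; [|r| + 1] keeps its radius
   positive. *)
pose R0 : R := (mdist x y + `|r| + 1)%R.
have R00 : (0 < R0)%R by rewrite ltr_wpDl// addr_ge0// mdist_ge0.
have OmR0 : (Om : set X) `<=` ball x R0.
  move=> z /Omr; rewrite !ballEmdist/= => yz.
  apply: le_lt_trans (metric_triangle _ y _) _.
  rewrite /R0 -addrA ltrD2l (lt_le_trans yz)//.
  by rewrite (le_trans (ler_norm r))// lerDl.
(* Chosen so that e m t^s = k (2 R0 t)^s; since s < a, (2^-n)^(a - s) <= k for all large n. *)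
pose k := (e * m / (2 * R0) `^ s)%R.
have k0 : (0 < k)%R by rewrite divr_gt0 ?mulr_gt0// powR_gt0// mulr_gt0.
have [n1 n0n1 n1k] : exists2 n1, (n0 <= n1)%N &
    forall n, (n1 <= n)%N -> ((2^-1 `^ (a - s)) ^+ n <= k)%R.
  have q1 : (`|2^-1 `^ (a - s)| < 1 :> R)%R.
    by rewrite ger0_norm ?powR_ge0// powR_half_lt1// subr_gt0.
  have [N _ Nk] := geometric_le 1%R q1 k0.
  exists (maxn n0 N) => [|n]; first exact: leq_maxl.
  by rewrite geq_max => /andP[_ /Nk]; rewrite /= mul1r.
(* For t < [del], t is a ratio below 1 and t R0 < 2^-n1, so the dyadic scale found below is at least
   [n1]. *)
pose del : R := Num.min 1%R (2^-1 ^+ n1 / R0)%R.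
have del0 : (0 < del)%R by rewrite lt_min ltr01/= divr_gt0// exprn_gt0.
pose W := [set t | 0 < t]%R `&` [set t | t < del]%R.
have W0 : (0%R : R)^'+ W.
  by apply: filterI; [exact: nbhs_right_gt|exact: nbhs_right_lt].
have /ereal_sup_gt[_ [t [/= t0 +] <-] et] :
    e%:E < ereal_sup (homothety_ratio mu C Phi s x Om @` W).
  by apply: lt_le_trans eL _; apply: ereal_inf_lbound; exists W.
rewrite lt_min => /andP[t1 tn1].
have [n n1n /andP[nu un]] := @dyadic_scale R (t * R0)%R n1 (mulr_gt0 t0 R00)
  (ltW (etrans (esym (ltr_pdivlMr _ _ R00)) tn1)).
exists n; first exact: leq_trans n0n1 n1n.
have mball : measurable (ball x (2^-1 ^+ n)%R : set (borel X)).
  exact: measurable_ball.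
(* Since 2^-n < 2 R0 t, (2^-n)^a = (2^-n)^(a - s) (2^-n)^s <= k (2 R0 t)^s. *)
apply: (@le_trans _ _ (e * t `^ s * m)%:E).
  rewrite lee_fin -(subrK s a) powRD; last first.
    by apply/implyP => _; rewrite gt_eqF// exprn_gt0.
  have w0 : (0 < 2 * R0)%R by rewrite mulr_gt0.
  have -> : (e * t `^ s * m = k * ((2 * R0) * t) `^ s)%R.
    rewrite (powRM _ (ltW w0) (ltW t0)) mulrA divfK; first by rewrite mulrAC.
    by rewrite gt_eqF// powR_gt0.
  rewrite ler_pM ?powR_ge0//; first by rewrite powR_exprn// n1k.
  rewrite ge0_ler_powR ?nnegrE ?ltW ?exprn_gt0 ?mulr_gt0//.
  by move: nu; rewrite exprS ltr_pdivrMl// mulrCA [ltRHS]mulrC.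
apply: (@le_trans _ _ ((mu^*)%mu (homothety C Phi x t Om))).
  move: et; rewrite /homothety_ratio mE inver gt_eqF//.
  have := mu_ext_ge0 (measure_ge0 mu) (homothety C Phi x t Om).
  case: ((mu^*)%mu _) => [M| |]//; last by move=> _ _; exact: leey.
  rewrite -!EFinM lte_fin !lee_fin => _ /ltW.
  by rewrite mulrC mulrAC ler_pdivlMr// ler_pdivlMr ?powR_gt0// mulrAC.
(* The homothety may fail to be measurable, so monotonicity is applied to the outer measure, which
   agrees with [mu] on the ball. *)
rewrite -(measurable_mu_extE mu mball); apply: le_mu_ext.
apply: subset_trans (homothety_sub_ball t0 (ltW t1) OmR0) _.
by apply: le_ball.
Qed.

End geodesic_dim.

(** * The dimension inequality *)

Unset Implicit Arguments.

(* The supremum of the empty set is 0, hence `supremum 0` instead of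
   `ereal_sup`. *)
Theorem theorem4 (R : realType) (X : pmetricType R)
    (mu : {measure set (borel X) -> \bar R})
    (C : X -> set X) (Phi : X -> X -> R -> X)
    (hX : metric_measure_space mu C Phi)
    (B : set (borel X)) (mB : measurable B) :
  supremum 0 [set geodesic_dim mu C Phi x | x in (B : set X)] >=
    hausdorff_dim (B : set X).
Proof.
pose N := [set geodesic_dim mu C Phi x | x in (B : set X)].
have N_ge0 : 0 <= supremum 0 N.
  apply: supremum0_ge0 => _ [x _ <-]; apply: le_ereal_inf_tmp => _ [s [s0 _] <-].
  by rewrite lee_fin ltW.
have N_ub x : B x -> geodesic_dim mu C Phi x <= supremum 0 N.
  move=> Bx; apply: ge_supremum_Nmem; first exact: ereal_supremums_neq0.
  by exists x.
move: N_ge0 N_ub; rewrite -/N; case: (supremum 0 N) => [r| |]//; last first.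
  by move=> _ _; exact: leey.
rewrite lee_fin => r0 N_ub.
apply/lee_addgt0Pr => e e0; apply: ereal_inf_lbound; exists (r + e)%R => //.
have re0 : (0 <= r + e)%R by rewrite addr_ge0// ltW.
(* The exponent r + e/2 lies strictly between the geodesic dimensions, all at most r, and r + e:
   both lemmas need a strict gap. *)
split=> //; apply: (@hausdorff_measure_density0 _ _ mu _ (r + e / 2)%R) => //.
- by rewrite ltrD2l ltr_pdivrMr// ltr_pMr// ltr1n.
- by move=> x s s0; have /andP[] := mms_ball hX x s0.
- move=> x n0 Bx; apply: (geodesic_dim_lt_ball hX).
  apply: le_lt_trans (N_ub _ Bx) _.
  by rewrite lte_fin ltrDl divr_gt0.
Qed.
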